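(* Let $f:\mathbb{R}\to[0,\infty)$ be a nonnegative function with $f\in L^1(\mathbb{R})$, and suppose $\#crests(f)=N$, where $N$ is a positive integer. Then $$|\widehat f(z)|\leq N\pi\sqrt{10}\int_0^{1/z} f^*(x)\,dx$$ for all $z>0$.
   Context: The Fourier transform of $f\in L^1(\mathbb{R})$ is $\widehat f(z)=\int_{\mathbb{R}} f(x)e^{-ixz}\,dx$, $z\in\mathbb{R}$. The decreasing rearrangement of $f$ is $f^*(x)=\inf\{\alpha>0 : |\{t:|f(t)|>\alpha\}|\le x\}$, where $|\cdot|$ of a set is Lebesgue measure. ''Increasing'' and ''decreasing'' are meant in the wide (non-strict) sense. A nonnegative function $f$ on $\mathbb{R}$ crests once, written $\#crests(f)=1$, if there exists a point $b\in\mathbb{R}$ such that $f(x)$ is increasing for $x<b$ and decreasing for $x>b$. Two functions have almost disjoint support if the intersection of their supports has Lebesgue measure zero. In general, for a nonnegative function $f$ on $\mathbb{R}$, $\#crests(f)$ is the minimum of all integers $N\ge 1$ such that $f=\sum_{i=1}^N f_i$ for some nonnegative functions $f_1,\dots,f_N$ with (pairwise) almost disjoint supports, each of which crests once; if no such $N$ exists, $\#crests(f)=\infty$. *)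

(* Defs.v *)
From mathcomp Require Import all_boot all_order all_algebra.
From mathcomp Require Import complex.
From mathcomp Require Import all_classical all_reals all_analysis.

Set Implicit Arguments.
Unset Strict Implicit.
Unset Printing Implicit Defensive.

Import Order.TTheory GRing.Theory Num.Theory.
Import numFieldNormedType.Exports.

Local Open Scope classical_set_scope.
Local Open Scope ring_scope.

Definition expi (R : realType) (t : R) : R[i] := Complex (cos t) (sin t).

Definition cintegral (R : realType) (F : R -> R[i]) : R[i] :=
  Complex (Rintegral lebesgue_measure setT (fun x => complex.Re (F x)))
          (Rintegral lebesgue_measure setT (fun x => complex.Im (F x))).

Definition fourier (R : realType) (f : R -> R) (z : R) : R[i] :=
  cintegral (fun x => real_complex R (f x) * expi (- (x * z))).

(* Extended-real valued: the infimum of the empty set is +oo, which for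
   integrable f can only happen at x = 0 (f essentially unbounded). *)
Definition rearrangement (R : realType) (f : R -> R) (x : R) : \bar R :=
  ereal_inf [set a%:E | a in
    [set a : R | 0 < a /\
      (lebesgue_measure [set t : R | (a < `|f t|)%R] <= x%:E)%E]].

(* The value at the point b itself is unconstrained. *)
Definition crests_once (R : realType) (f : R -> R) : Prop :=
  exists b : R, {in `]-oo, b[ &, nondecreasing_fun f} /\
                {in `]b, +oo[ &, nonincreasing_fun f}.

(* For nonnegative functions cresting once, [set x | f x != 0] is an interval up
   to one point, so taking the closure only adds a null set. *)
Definition supp (R : realType) (f : R -> R) : set R :=
  closure [set x | f x != 0].

Definition almost_disjoint_supp (R : realType) (f g : R -> R) : Prop :=
  lebesgue_measure (supp f `&` supp g) = 0%E.

Definition sum_of_crests (R : realType) (f : R -> R) (N : nat) : Prop :=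
  exists F : 'I_N -> R -> R,
    [/\ forall i x, 0 <= F i x,
        forall i, crests_once (F i),
        forall i j, i != j -> almost_disjoint_supp (F i) (F j) &
        forall x, f x = \sum_(i < N) F i x].

(* None stands for an infinite number of crests. *)
Definition crests (R : realType) (f : R -> R) : option nat :=
  if pselect (exists N, `[< (1 <= N)%N /\ sum_of_crests f N >]) is left ex
  then Some (ex_minn ex) else None.

(* Main.v *)
Require Import Defs.
From mathcomp Require Import all_boot all_order all_algebra.
From mathcomp Require Import complex.
From mathcomp Require Import all_classical all_reals all_analysis.
From mathcomp Require Import measurable_realfun.
From mathcomp Require Import ring lra.

Import Order.TTheory GRing.Theory Num.Theory.
Import numFieldNormedType.Exports.

Local Open Scope classical_set_scope.
Local Open Scope ring_scope.

(** A sum of [N] crests is handled one crest at a time: each summand [F] lies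
    between [0] and [f], and the real and imaginary parts of its transform are
    integrals [int F w] where [w] is a cosine or a sine, so that [|w| <= 1] and
    [w (x + c) = - w x] with the half period [c = pi / z].

    A crest about [b] is cut at [b] into two slopes, each of which becomes, after
    an isometry of the line, a function [g] that vanishes on the nonpositive
    axis and decreases on the positive one.  Translating by the half period gives
    [2 int g w = int (g x - g (x + c)) w x], and the oscillation
    [|g x - g (x + c)|] telescopes because [g] is monotone: its integral is
    exactly twice the integral of [g] from [0] to [c] (half_crest_oscillation).

    With [h = 1 / z] the half period is [c = pi h], and rescaling by [pi] turns
    the integral of [g] from [0] to [c] into [pi] times that of [g (pi x)] from
    [0] to [h].  There [g (pi x) <= f^* x] pointwise: if [a < g (pi x)] then [f]
    exceeds [a] on an interval of length [pi x > x]
    (half_crest_le_rearrangement).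

    So each slope contributes at most [pi I], with [I] the integral of [f^*] from
    [0] to [1 / z]; each of the two parts of the transform of [f] is at most
    [2 pi N I], and the modulus is at most [2 sqrt 2 pi N I <= sqrt 10 pi N I]. *)

(** * Affine changes of variable for the Lebesgue integral *)

Lemma measurable_affine {R : realType} (a l : R) :
  measurable_fun [set: measurableTypeR R]
    (fun x : measurableTypeR R => (a + l * x : measurableTypeR R)).
Proof. by apply: measurable_funD => //; exact: measurable_funM. Qed.

(** By uniqueness of the Lebesgue measure it is enough to compare lengths of
    half-open intervals; the preimage changes its open end when [l < 0]. *)
Lemma lebesgue_measure_affine_preimage {R : realType} (a l : R) (l0 : l != 0)
    (A : set (measurableTypeR R)) : measurable A ->
  (`|l|%:E * lebesgue_measure ((fun x : R => (a + l * x)%R) @^-1` A) =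
   lebesgue_measure A)%E.
Proof.
move=> mA.
pose phi := fun x : measurableTypeR R => (a + l * x : measurableTypeR R).
have mphi : measurable_fun setT phi by exact: measurable_affine.
pose nu : {measure set (measurableTypeR R) -> \bar R} :=
  pushforward lebesgue_measure phi.
pose m := mscale (NngNum (normr_ge0 l)) (nu mphi).
suff -> : (lebesgue_measure A = m A)%E by [].
apply: lebesgue_measure_unique => //= _ [[u v]] _ <-.
rewrite /m/= /mscale/= /pushforward lebesgue_measure_itv/=.
have [l_gt0|l_lt0|] := ltgtP 0 l; last by move=> e; rewrite -e eqxx in l0.
- have -> : phi @^-1` `]u, v]%classic = `](u - a) / l, (v - a) / l]%classic.
    apply/seteqP; split => x; rewrite /phi/= !in_itv/= => /andP[ux xv];
    rewrite ltr_pdivrMr// ler_pdivlMr// in ux xv *; apply/andP; split; lra.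
  rewrite lebesgue_measure_itv/= !lte_fin ltr_pM2r ?invr_gt0// ltrD2r.
  case: ifPn => _; last by rewrite mule0.
  by rewrite -!EFinD -EFinM gtr0_norm//; congr EFin; field; rewrite gt_eqF.
- have -> : phi @^-1` `]u, v]%classic = `[(v - a) / l, (u - a) / l[%classic.
    apply/seteqP; split => x; rewrite /phi/= !in_itv/= => /andP[ux xv];
    rewrite ltr_ndivlMr// ler_ndivrMr// in ux xv *; apply/andP; split; lra.
  rewrite lebesgue_measure_itv/= !lte_fin ltr_nM2r ?invr_lt0// ltrD2r.
  case: ifPn => _; last by rewrite mule0.
  by rewrite -!EFinD -EFinM ltr0_norm//; congr EFin; field; rewrite lt_eqF.
Qed.

Lemma ge0_integral_affine {R : realType} (a l : R) (l0 : l != 0) (f : R -> \bar R) :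
  measurable_fun [set: R] f -> (forall x, 0 <= f x)%E ->
  (`|l|%:E * \int[lebesgue_measure]_x f (a + l * x)%R =
   \int[lebesgue_measure]_x f x)%E.
Proof.
move=> mf f0.
have mphi := measurable_affine a l.
rewrite -[X in (_ * X)%E](@ge0_integral_pushforward _ _ (measurableTypeR R)
  (measurableTypeR R) R _ mphi lebesgue_measure setT f)//.
pose nu : {measure set (measurableTypeR R) -> \bar R} := pushforward lebesgue_measure
  (fun x : measurableTypeR R => (a + l * x : measurableTypeR R)).
rewrite -(@ge0_integral_mscale _ _ R (nu mphi) setT measurableT
  (NngNum (normr_ge0 l)))//.
apply: eq_measure_integral => A mA _.
exact: lebesgue_measure_affine_preimage.
Qed.

Lemma integral_isometry {R : realType} (a l : R) (l1 : `|l| = 1) (f : R -> \bar R) :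
  measurable_fun [set: R] f ->
  (\int[lebesgue_measure]_x f (a + l * x)%R = \int[lebesgue_measure]_x f x)%E.
Proof.
move=> mf; have l0 : l != 0 by rewrite -normr_gt0 l1.
have ge0_isometry (g : R -> \bar R) : measurable_fun [set: R] g ->
    (forall x, 0 <= g x)%E ->
    (\int[lebesgue_measure]_x g (a + l * x)%R = \int[lebesgue_measure]_x g x)%E.
  by move=> mg g0; rewrite -(ge0_integral_affine a l l0 g mg g0) l1 mul1e.
rewrite integralE [RHS]integralE; congr (_ - _)%E.
- rewrite -(ge0_isometry f^\+%E)//; last exact: measurable_funepos.
  by apply: eq_integral => x _; rewrite !funeposE.
- rewrite -(ge0_isometry f^\-%E)//; last exact: measurable_funeneg.
  by apply: eq_integral => x _; rewrite !funenegE.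
Qed.

Lemma integrable_isometry {R : realType} (a l : R) (l1 : `|l| = 1) (f : R -> \bar R) :
  lebesgue_measure.-integrable setT f ->
  lebesgue_measure.-integrable setT (fun x : R => f (a + l * x)).
Proof.
move=> /integrableP[mf foo]; apply/integrableP; split.
  by apply: measurableT_comp => //; exact: measurable_affine.
rewrite (@integral_isometry _ a l l1 (fun x => `|f x|%E))//.
exact: measurableT_comp.
Qed.

(** * Oscillation of a decreasing slope *)

(** The normal form of one slope of a crest: its summit is at [0], where the
    value is set to [0] so that the value of the crest at its summit, which can
    be arbitrary, never matters. *)
Definition half_crest {R : realType} (g : R -> R) : Prop :=
  [/\ forall x, 0 <= g x, forall x, x <= 0 -> g x = 0 &
      forall x y, 0 < x -> x <= y -> g y <= g x].

(** Its superlevel sets are intervals. *)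
Lemma half_crest_measurable {R : realType} (g : R -> R) :
  half_crest g -> measurable_fun [set: R] g.
Proof.
move=> [g0 gneg gdec].
apply: (measurability (@RGenCInfty.G R)) => [|/= _ [_] [r] -> <-].
  exact: RGenCInfty.measurableE.
rewrite setTI; have [r0|r0] := lerP r 0.
  have -> : g @^-1` `[r, +oo[ = setT; last by [].
  by apply/seteqP; split => x //= _; rewrite in_itv/= andbT (le_trans r0).
apply: is_interval_measurable => s t/=.
rewrite !in_itv/= !andbT => gs gt u /andP[su ut].
rewrite in_itv/= andbT (le_trans gt)// gdec//.
apply: lt_le_trans su; rewrite ltNge; apply/negP => /gneg s0.
by rewrite s0 leNgt r0 in gs.
Qed.

(** Since [w] changes sign under translation by [c], the integral is half of that
    of [(g x - g (x + c)) w x]; by monotonicity the absolute value of the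
    difference is the difference itself, which integrates to [0], except when
    [0 < x + c <= c], where the correction is [2 g (x + c)]. *)
Lemma half_crest_oscillation {R : realType} (g w : R -> R) (c : R) :
  half_crest g -> lebesgue_measure.-integrable setT (EFin \o g) ->
  measurable_fun [set: R] w -> (forall x, `|w x| <= 1) -> 0 < c ->
  (forall x, w (x + c) = - w x) ->
  `|\int[lebesgue_measure]_x (g x * w x)| <=
     \int[lebesgue_measure]_(x in `]0, c]) g x.
Proof.
move=> [g0 gneg gdec] ig mw w1 c0 wc.
have mulw (h : R -> R) : lebesgue_measure.-integrable setT (EFin \o h) ->
    lebesgue_measure.-integrable setT (EFin \o (fun x => h x * w x)).
  move=> ih.
  apply: (@le_integrable _ _ _ lebesgue_measure setT measurableT _ (EFin \o h)) => //.
    apply/measurable_EFinP; apply: measurable_funM => //.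
    by apply/measurable_EFinP; apply: measurable_int ih.
  by move=> x _ /=; rewrite lee_fin normrM ler_piMr.
have shift (h : R -> R) : lebesgue_measure.-integrable setT (EFin \o h) ->
    \int[lebesgue_measure]_x h (x + c) = \int[lebesgue_measure]_x h x.
  move=> ih; rewrite /Rintegral -(@integral_isometry R c 1 (normr1 _) (EFin \o h)).
    by congr fine; apply: eq_integral => x _; rewrite mul1r addrC.
  exact: measurable_int ih.
have ishift (h : R -> R) : lebesgue_measure.-integrable setT (EFin \o h) ->
    lebesgue_measure.-integrable setT (EFin \o (fun x => h (x + c))).
  move=> /(@integrable_isometry _ c 1 (normr1 _)).
  by apply: eq_integrable => // x _ /=; rewrite mul1r addrC.
set J := \int[lebesgue_measure]_x (g x * w x).
have i1 := mulw _ ig.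
have i2 := mulw _ (ishift _ ig).
have eJ : \int[lebesgue_measure]_x (g (x + c) * w x) = - J.
  rewrite /J -(shift _ i1) -mulN1r -RintegralZl//; last exact: (ishift _ i1).
  by apply: eq_Rintegral => x _; rewrite wc; ring.
have e2J : 2 * J = \int[lebesgue_measure]_x ((g x - g (x + c)) * w x).
  rewrite (_ : (fun x => _) = (fun x => g x * w x - g (x + c) * w x)); last first.
    by apply/funext => x; ring.
  by rewrite RintegralB// eJ -/J; ring.
pose gc := g \_ `]0, c].
have igc : lebesgue_measure.-integrable setT (EFin \o gc).
  rewrite /gc -restrict_EFin; apply/integrable_restrict => //.
  by rewrite setTI; exact: integrableS ig.
have idiff : lebesgue_measure.-integrable setT (EFin \o (fun x => g x - g (x + c))).
  exact: (integrableB measurableT ig (ishift _ ig)).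
have key x : `|g x - g (x + c)| = g x - g (x + c) + 2 * gc (x + c).
  have -> : gc (x + c) = if (x + c) \in `]0, c]%classic then g (x + c) else 0 by [].
  have [x0|x0] := lerP x 0.
    rewrite (gneg x)// sub0r normrN ger0_norm//.
    case: ifPn => [_|]; first by ring.
    rewrite notin_setE/= in_itv/= => /negP; rewrite negb_and -leNgt -ltNge.
    by move=> /orP[/gneg->|]; [ring|lra].
  rewrite ifF; first by rewrite mulr0 addr0 ger0_norm// subr_ge0 gdec//; lra.
  by apply/negbTE; rewrite notin_setE/= in_itv/= => /andP[]; lra.
have i2gc : lebesgue_measure.-integrable setT (EFin \o (fun x => 2 * gc (x + c))).
  exact: (integrableZl measurableT 2 (ishift _ igc)).
suff : 2 * `|J| <= 2 * \int[lebesgue_measure]_(x in `]0, c]) g x by lra.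
rewrite -{1}(ger0_norm (ler0n R 2)) -normrM e2J.
apply: le_trans (le_normr_Rintegral measurableT (mulw _ idiff)) _.
apply: (@le_trans _ _ (\int[lebesgue_measure]_x (g x - g (x + c) + 2 * gc (x + c)))).
  apply: le_Rintegral => //.
  - exact: (integrable_norm (mulw _ idiff)).
  - exact: (integrableD measurableT idiff i2gc).
  - by move=> x _; rewrite -key normrM ler_piMr.
rewrite RintegralD// RintegralB//; last exact: (ishift _ ig).
rewrite RintegralZl//; last exact: (ishift _ igc).
by rewrite shift// subrr add0r shift// [in leRHS]Rintegral_mkcond.
Qed.

(** * Comparison with the decreasing rearrangement *)

(** The integral of a nonnegative function is a supremum over the simple
    functions below it, so monotonicity holds without measurability; it will be
    applied to the rearrangement, an infimum over uncountably many levels. *)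
Lemma ge0_le_integral_setT {R : realType} (f1 f2 : R -> \bar R) :
  (forall x, 0 <= f1 x)%E -> (forall x, f1 x <= f2 x)%E ->
  (\int[lebesgue_measure]_x f1 x <= \int[lebesgue_measure]_x f2 x)%E.
Proof.
move=> f10 f12.
have f20 x : (0 <= f2 x)%E by exact: le_trans (f12 x).
rewrite !ge0_integralTE//; apply: ereal_sup_le => _ [h hf <-].
by exists h => // x; exact: le_trans (f12 x).
Qed.

Lemma rearrangement_ge0 {R : realType} (f : R -> R) (x : R) :
  (0 <= rearrangement f x)%E.
Proof.
by apply: le_ereal_inf_tmp => _ [a [a0 _] <-]; rewrite lee_fin ltW.
Qed.

(** The stretch [l > 1] is what makes the pointwise bound [g (l x) <= f^* x] hold
    at every [x > 0]: for [l = 1] it can fail where [g] jumps. *)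
Lemma half_crest_le_rearrangement {R : realType} (f g : R -> R) (l h : R) :
  1 < l -> half_crest g ->
  (forall a y, 0 < a -> a < g y ->
     (y%:E <= lebesgue_measure [set t | (a < `|f t|)%R])%E) ->
  (\int[lebesgue_measure]_(x in `]0%R, (l * h)%R]) (g x)%:E <=
   l%:E * \int[lebesgue_measure]_(x in `[0%R, h]) rearrangement f x)%E.
Proof.
move=> l1 hg fg; have [g0 gneg gdec] := hg.
have l0 : 0 < l by lra.
rewrite integral_mkcond [X in (_ * X)%E]integral_mkcond.
have pos x : (0 <= ((EFin \o g) \_ `]0%R, (l * h)%R]) x)%E.
  by apply: erestrict_ge0 => y _; rewrite lee_fin.
have mgl : measurable_fun [set: R] ((EFin \o g) \_ `]0, (l * h)]).
  apply/(measurable_restrictT _ _).1 => //; apply: measurable_funTS.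
  by apply/measurable_EFinP; exact: half_crest_measurable.
rewrite -(@ge0_integral_affine R 0 l (lt0r_neq0 l0) _ mgl pos) gtr0_norm//.
rewrite lee_pmul2l//; apply: ge0_le_integral_setT => // x.
rewrite add0r !patchE; case: ifPn => [|_]; last first.
  by case: ifPn => // _; exact: rearrangement_ge0.
rewrite inE/= in_itv/= pmulr_rgt0// ler_pM2l// => /andP[x0 xh].
rewrite ifT; last by rewrite inE/= in_itv/= xh (ltW x0).
apply: le_ereal_inf_tmp => _ [a [a0 ma] <-]; rewrite lee_fin leNgt; apply/negP.
move=> /(fg _ _ a0)/le_trans/(_ ma); rewrite lee_fin leNgt => /negP; apply.
by rewrite ltr_pMl.
Qed.

(** * The two slopes of a crest *)

(** The slope of [F] on the right of [b] for [e = 1], on its left for [e = -1],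
    seen from [b]. *)
Definition side {R : realType} (F : R -> R) (b e x : R) : R :=
  if 0 < x then F (b + e * x) else 0.

Lemma half_crest_side {R : realType} (F : R -> R) (b e : R) :
  `|e| = 1 -> (forall x, 0 <= F x) ->
  {in `]-oo, b[ &, nondecreasing_fun F} ->
  {in `]b, +oo[ &, nonincreasing_fun F} ->
  half_crest (side F b e).
Proof.
move=> e1 F0 Fl Fr; rewrite /side; split => [x|x|x y x0 xy].
- by case: ifPn.
- by rewrite leNgt => /negbTE ->.
- rewrite x0 (lt_le_trans x0 xy); have y0 := lt_le_trans x0 xy.
  have [e0|e0] := lerP 0 e.
    have -> : e = 1 by rewrite -e1 ger0_norm.
    by apply: Fr; rewrite ?in_itv/= ?andbT; lra.
  have -> : e = -1 by rewrite -e1 ltr0_norm// opprK.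
  by apply: Fl; rewrite ?in_itv/=; lra.
Qed.

(** A level reached at distance [y] from the summit is exceeded on the whole
    interval between them. *)
Lemma side_level {R : realType} (f F : R -> R) (b e : R) :
  `|e| = 1 -> measurable_fun [set: R] f -> (forall x, F x <= f x) ->
  half_crest (side F b e) ->
  forall a y, 0 < a -> a < side F b e y ->
     (y%:E <= lebesgue_measure [set t | (a < `|f t|)%R])%E.
Proof.
move=> e1 mf Ff [_ _ gdec] a y a0 ay.
have y0 : 0 < y.
  by rewrite ltNge; apply/negP => y0; move: ay; rewrite /side [0 < y]ltNge y0/=; lra.
have e0 : e != 0 by rewrite -normr_gt0 e1.
have ee : e * e = 1 by rewrite -expr2 -real_normK ?num_real// e1 expr1n.
rewrite -(@lebesgue_measure_affine_preimage R b e e0)/=; last first.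
  have := measurableT_comp (@normr_measurable R setT) mf.
  move=> /(_ measurableT _ (measurable_itv `]a, +oo[)).
  by congr measurable; rewrite setTI; apply/seteqP; split => x/=; rewrite in_itv/= andbT.
rewrite e1 mul1e.
have -> : y%:E = lebesgue_measure (`]0, y]%classic : set R).
  by rewrite lebesgue_measure_itv/= lte_fin y0 sube0.
apply: le_measure; rewrite ?inE//.
  have := measurable_affine b e.
  move=> /(measurableT_comp mf)/(measurableT_comp (@normr_measurable R setT)).
  move=> /(_ measurableT _ (measurable_itv `]a, +oo[)).
  by congr measurable; rewrite setTI; apply/seteqP; split => x/=; rewrite in_itv/= andbT.
move=> x/=; rewrite in_itv/= => /andP[x0 xy].
apply: lt_le_trans (ler_norm _); apply: lt_le_trans (Ff _).
by apply: lt_le_trans ay _; have := gdec _ _ x0 xy; rewrite {2}/side x0.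
Qed.

(** Both [side F b e] and the weight [w (b + e x)], which has the same half
    period as [w], satisfy the hypotheses of the oscillation bound. *)
Lemma side_bound {R : realType} (f F w : R -> R) (b e h : R) :
  `|e| = 1 -> lebesgue_measure.-integrable setT (EFin \o f) ->
  (forall x, F x <= f x) -> half_crest (side F b e) ->
  measurable_fun [set: R] w -> (forall x, `|w x| <= 1) -> 0 < h ->
  (forall x, w (x + pi * h) = - w x) ->
  lebesgue_measure.-integrable setT (EFin \o side F b e) /\
  (`|\int[lebesgue_measure]_x (side F b e x * w (b + e * x))|%:E <=
     pi%:E * \int[lebesgue_measure]_(x in `[0%R, h]) rearrangement f x)%E.
Proof.
move=> e1 fi Ff hs mw w1 h0 wh.
have [s0 _ _] := hs.
have mf : measurable_fun [set: R] f by apply/measurable_EFinP; apply: measurable_int fi.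
have si : lebesgue_measure.-integrable setT (EFin \o side F b e).
  apply: (@le_integrable _ _ _ lebesgue_measure setT measurableT _
    (fun x => (`|f (b + e * x)|)%:E)).
  - by apply/measurable_EFinP; exact: half_crest_measurable.
  - move=> x _ /=; rewrite lee_fin normr_id ger0_norm// /side.
    case: ifPn => // _; exact: le_trans (Ff _) (ler_norm _).
  - exact: (@integrable_isometry R b e e1 _ (integrable_norm fi)).
split => //.
apply: (@le_trans _ _
    (\int[lebesgue_measure]_(x in `]0%R, (pi * h)%R]) (side F b e x)%:E)%E); last first.
  apply: half_crest_le_rearrangement => //; first by have := pi_ge2 R; lra.
  exact: side_level.
have := @half_crest_oscillation R (side F b e) (fun x => w (b + e * x)) (pi * h)
  hs si _ _ _ _.
rewrite -lee_fin /Rintegral => H; apply: le_trans (H _ _ _ _) _.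
- exact: measurableT_comp mw (measurable_affine b e).
- by [].
- by rewrite mulr_gt0// pi_gt0.
- move=> x; have [e0|e0] := lerP 0 e.
    have -> : e = 1 by rewrite -e1 ger0_norm.
    by rewrite -wh; congr w; ring.
  have -> : e = -1 by rewrite -e1 ltr0_norm// opprK.
  by rewrite -[LHS]opprK -(wh (b + -1 * (x + pi * h))); congr (- _); congr w; ring.
- rewrite fineK//; apply: integrable_fin_num => //.
  exact: integrableS si.
Qed.

(** A crest is the sum of its two slopes put back in place and of its value at
    the summit, which is integrated over a null set. *)
Lemma crest_bound {R : realType} (f F w : R -> R) (h : R) :
  lebesgue_measure.-integrable setT (EFin \o f) ->
  (forall x, 0 <= F x) -> (forall x, F x <= f x) -> crests_once F ->
  measurable_fun [set: R] w -> (forall x, `|w x| <= 1) -> 0 < h ->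
  (forall x, w (x + pi * h) = - w x) ->
  lebesgue_measure.-integrable setT (EFin \o (fun x => F x * w x)) /\
  (`|\int[lebesgue_measure]_x (F x * w x)|%:E <=
     (2 * pi)%:E * \int[lebesgue_measure]_(x in `[0%R, h]) rearrangement f x)%E.
Proof.
move=> fi F0 Ff [b [Fl Fr]] mw w1 h0 wh.
(* The argument of [side] is [e (x - b)], the inverse of [x |-> b + e x]. *)
pose S e x := side F b e (- (e * b) + e * x).
have sideP e : `|e| = 1 ->
    lebesgue_measure.-integrable setT (EFin \o (fun x => S e x * w x)) /\
    (`|\int[lebesgue_measure]_x (S e x * w x)|%:E <=
       pi%:E * \int[lebesgue_measure]_(x in `[0%R, h]) rearrangement f x)%E.
  move=> e1; have hs := half_crest_side F b e e1 F0 Fl Fr.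
  have [si sb] := side_bound f F w b e h e1 fi Ff hs mw w1 h0 wh.
  have Swi : lebesgue_measure.-integrable setT (EFin \o (fun x => S e x * w x)).
    apply: (@le_integrable _ _ _ lebesgue_measure setT measurableT _ (EFin \o S e)) => //.
    - apply/measurable_EFinP; apply: measurable_funM => //.
      apply: measurableT_comp (measurable_affine _ _).
      exact: half_crest_measurable.
    - by move=> x _ /=; rewrite lee_fin normrM ler_piMr.
    - exact: (@integrable_isometry R _ e e1 _ si).
  split => //; apply: le_trans sb.
  rewrite /Rintegral -(@integral_isometry R b e e1 (EFin \o (fun x => S e x * w x))).
    rewrite lee_fin le_eqVlt; apply/orP; left; apply/eqP; congr (`|fine _|).
    apply: eq_integral => x _ /=; congr ((_ * _)%:E); congr side.
    have ee : e * e = 1 by rewrite -expr2 -real_normK ?num_real// e1 expr1n.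
    by rewrite mulrDr mulrA ee mul1r addrA addNr add0r.
  exact: measurable_int Swi.
have [ri rb] := sideP 1 (normr1 _).
have [|li lb] := sideP (-1); first by rewrite normrN1.
pose P := (fun x => F x * w x) \_ [set b].
have Pi : lebesgue_measure.-integrable setT (EFin \o P).
  rewrite /P -restrict_EFin; apply: (integrable_mkcond _ _).1 => //.
  apply: null_set_integrable => //; last exact: lebesgue_measure_set1.
  exact: measurable_fun_set1.
have P0 : \int[lebesgue_measure]_x P x = 0.
  by rewrite -Rintegral_mkcond Rintegral_set1.
have FE : (fun x => F x * w x) = (fun x => S 1 x * w x + S (-1) x * w x + P x).
  apply/funext => x.
  have -> : P x = if x \in [set b] then F x * w x else 0 by [].
  rewrite /S /side; have [xb|xb|->] := ltgtP x b.
  - rewrite [_ < _]ltNge (_ : _ <= 0)/=; last by lra.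
    rewrite ifT; last by lra.
    rewrite ifF; last by apply/negbTE; rewrite notin_setE/=; lra.
    by rewrite mul0r add0r addr0; congr (F _ * _); ring.
  - rewrite ifT; last by lra.
    rewrite [_ < _]ltNge (_ : _ <= 0)/=; last by lra.
    rewrite ifF; last by apply/negbTE; rewrite notin_setE/=; lra.
    by rewrite mul0r !addr0; congr (F _ * _); ring.
  - rewrite [0 < _]ltNge (_ : _ <= 0)/=; last by lra.
    rewrite [0 < _]ltNge (_ : _ <= 0)/=; last by lra.
    by rewrite ifT ?inE// !mul0r !add0r.
have iRL : lebesgue_measure.-integrable setT
    (EFin \o (fun x => S 1 x * w x + S (-1) x * w x)).
  exact: (integrableD measurableT ri li).
split; first by rewrite FE; exact: (integrableD measurableT iRL Pi).
rewrite FE RintegralD// P0 addr0 RintegralD//.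
apply: (@le_trans _ _ (`|\int[lebesgue_measure]_x (S 1 x * w x)|%:E +
  `|\int[lebesgue_measure]_x (S (-1) x * w x)|%:E)%E).
  by rewrite -EFinD lee_fin ler_normD.
have -> : 2 * pi = pi + pi :> R by ring.
rewrite EFinD ge0_muleDl ?lee_fin ?pi_ge0//; exact: leeD.
Qed.

(** * Sums of crests and the Fourier transform *)

(** Each summand is below [f], so the same rearrangement bounds all of them. *)
Lemma sum_of_crests_bound {R : realType} (f w : R -> R) (h : R) (N : nat) :
  lebesgue_measure.-integrable setT (EFin \o f) -> sum_of_crests f N ->
  measurable_fun [set: R] w -> (forall x, `|w x| <= 1) -> 0 < h ->
  (forall x, w (x + pi * h) = - w x) ->
  (`|\int[lebesgue_measure]_x (f x * w x)|%:E <=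
     \sum_(i < N)
       (2 * pi)%:E * \int[lebesgue_measure]_(x in `[0%R, h]) rearrangement f x)%E.
Proof.
move=> fi [F [F0 Fc _ fE]] mw w1 h0 wh.
have Ff i x : F i x <= f x.
  by rewrite fE (bigD1 i)//= lerDl sumr_ge0.
have Fi i := crest_bound f (F i) w h fi (F0 i) (Ff i) (Fc i) mw w1 h0 wh.
have -> : \int[lebesgue_measure]_x (f x * w x) =
    \sum_(i < N) \int[lebesgue_measure]_x (F i x * w x).
  rewrite /Rintegral.
  under eq_integral do rewrite fE mulr_suml -sumEFin.
  rewrite integral_sum//; last by move=> i; exact: (Fi i).1.
  by rewrite -sum_fine// => i _; apply: integrable_fin_num => //; exact: (Fi i).1.
apply: (@le_trans _ _ (\sum_(i < N) `|\int[lebesgue_measure]_x (F i x * w x)|%:E)%E).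
  by rewrite sumEFin lee_fin ler_norm_sum.
by apply: lee_sum => i _; exact: (Fi i).2.
Qed.

Lemma sum_of_crests_crests {R : realType} (f : R -> R) (N : nat) :
  crests f = Some N -> sum_of_crests f N.
Proof.
rewrite /crests; case: pselect => // ex [<-].
by case: ex_minnP => m /asboolP[].
Qed.

Lemma normc_le {R : realType} (u : R[i]) (m : R) :
  `|complex.Re u| <= m -> `|complex.Im u| <= m ->
  ComplexField.Normc.normc u <= Num.sqrt 2 * m.
Proof.
case: u => x y /= xm ym; have m0 : 0 <= m by exact: le_trans xm.
rewrite -[in leRHS](ger0_norm m0) -sqrtr_sqr -sqrtrM//; apply: ler_wsqrtr.
rewrite -(real_normK (num_real x)) -(real_normK (num_real y)).
have := normr_ge0 x; have := normr_ge0 y.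
by move=> y0 x0; rewrite mulr2n mulrDl !mul1r lerD// lerXn2r.
Qed.

Theorem theorem1 (R : realType) (f : R -> R) (N : nat)
  (f_ge0 : forall x, 0 <= f x)
  (f_L1 : lebesgue_measure.-integrable setT (EFin \o f))
  (N_gt0 : (0 < N)%N)
  (f_crests : crests f = Some N)
  (z : R) (z_gt0 : 0 < z) :
  ((ComplexField.Normc.normc (fourier f z))%:E <=
   (N%:R * pi * Num.sqrt 10)%:E *
     \int[lebesgue_measure]_(x in `[0%R, (1 / z)%R]) rearrangement f x)%E.
Proof.
have z0 : z != 0 by rewrite gt_eqF.
have mxz : measurable_fun [set: R] (fun x => - (x * z)).
  by apply: measurable_funN; exact: measurable_funM.
have h0 : 0 < 1 / z by rewrite divr_gt0.
have shift x : - ((x + pi * (1 / z)) * z) = - (x * z) - pi.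
  by field.
have fc := sum_of_crests_crests f N f_crests.
have := @sum_of_crests_bound R f (fun x => cos (- (x * z))) (1 / z) N f_L1 fc.
have := @sum_of_crests_bound R f (fun x => sin (- (x * z))) (1 / z) N f_L1 fc.
have I0 : (0 <= \int[lebesgue_measure]_(x in `[0%R, (1 / z)%R]) rearrangement f x)%E.
  by apply: integral_ge0 => x _; exact: rearrangement_ge0.
set I := (\int[lebesgue_measure]_(x in _) _)%E in I0 *.
move=> bs bc.
have {}bs : (`|complex.Im (fourier f z)|%:E <= \sum_(i < N) (2 * pi)%:E * I)%E.
  have -> : complex.Im (fourier f z) =
      \int[lebesgue_measure]_x (f x * sin (- (x * z))).
    by apply: eq_Rintegral => x _ /=; rewrite mul0r addr0.
  apply: bs => //.
  - by apply: measurableT_comp mxz; apply: continuous_measurable_fun; exact: continuous_sin.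
  - by move=> x; exact: sin_max.
  - by move=> x; rewrite shift -[in RHS](subrK pi (- (x * z))) sinDpi opprK.
have {}bc : (`|complex.Re (fourier f z)|%:E <= \sum_(i < N) (2 * pi)%:E * I)%E.
  have -> : complex.Re (fourier f z) =
      \int[lebesgue_measure]_x (f x * cos (- (x * z))).
    by apply: eq_Rintegral => x _ /=; rewrite mul0r subr0.
  apply: bc => //.
  - by apply: measurableT_comp mxz; apply: continuous_measurable_fun; exact: continuous_cos.
  - by move=> x; exact: cos_max.
  - by move=> x; rewrite shift -[in RHS](subrK pi (- (x * z))) cosDpi opprK.
have C0 : 0 < N%:R * pi * Num.sqrt 10 :> R.
  by rewrite !mulr_gt0 ?ltr0n ?pi_gt0 ?sqrtr_gt0.
(* The integral of the rearrangement may be infinite a priori. *)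
case: I I0 bs bc => [r| |] //; last by move=> _ _ _; rewrite gt0_muley ?lte_fin// leey.
rewrite lee_fin => r0.
rewrite -!EFinM sumEFin !lee_fin sumr_const card_ord => bs bc.
apply: le_trans (normc_le _ _ bc bs) _.
rewrite -[_ *+ N]mulr_natl.
have -> : Num.sqrt 2 * (N%:R * (2 * pi * r)) = N%:R * pi * (2 * Num.sqrt 2) * r :> R.
  by ring.
apply: ler_wpM2r => //; apply: ler_wpM2l; first by rewrite mulr_ge0// pi_ge0.
rewrite -[X in X * _](ger0_norm (ler0n R 2)) -sqrtr_sqr -sqrtrM ?sqr_ge0//.
by apply: ler_wsqrtr; lra.
Qed.
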